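(* For $n=6,7$ or $8$ the commutator subgroup $A_{E_n}'$ of the Artin group $A_{E_n}$ is a finitely presented group. $A_{E_n}'$ is the group generated by $$p_0=a_2a_1^{-1},\quad p_1=a_1a_2a_1^{-2},\quad q_\ell=a_\ell a_1^{-1}\ (3\le\ell\le n),\quad b=a_2a_1^{-1}a_3a_2^{-1},$$ with defining relations $$b=p_0q_3p_0^{-1},\quad p_0bp_0^{-1}=b^2q_3^{-1}b,\quad p_1q_3p_1^{-1}=q_3^{-1}b,\quad p_1bp_1^{-1}=(q_3^{-1}b)^3q_3^{-2}b,$$ $$p_0q_j=q_jp_1,\quad p_1q_j=q_jp_0^{-1}p_1\quad(4\le j\le n),$$ $$q_iq_{i+1}q_i=q_{i+1}q_iq_{i+1}\ (3\le i\le n-2),\quad q_nq_3q_n=q_3q_nq_3,$$ $$q_iq_j=q_jq_i\ (3\le i<j\le n-1,\ |i-j|\ge2),\quad q_iq_n=q_nq_i\ (4\le i\le n-1).$$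
   Context: $A_{E_n}$ ($n=6,7,8$) is the Artin group of type $E_n$: generators $a_1,\dots,a_n$ and relations $a_ia_j=a_ja_i$ for $1\le i<j\le n-1$, $|i-j|\ge2$; $a_ia_n=a_na_i$ for $i\ne3$; $a_ia_{i+1}a_i=a_{i+1}a_ia_{i+1}$ for $1\le i\le n-2$; $a_3a_na_3=a_na_3a_n$. $G'$ denotes the commutator subgroup of $G$. ''Generated by the listed elements with the listed defining relations'' means that the listed elements lie in $A_{E_n}'$ and that the obvious map from the abstract group with that presentation to $A_{E_n}'$ is an isomorphism. *)

(* Defs.v *)
From HB Require Import structures.
From mathcomp Require Import all_boot.
From mathcomp Require Import boolp.

Set Implicit Arguments.
Unset Strict Implicit.
Unset Printing Implicit Defensive.

Local Open Scope group_scope.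
Local Open Scope quotient_scope.

(* The free group on X: words in the letters (x, true) = x and
   (x, false) = x^-1, modulo insertion and deletion of adjacent inverse
   letters. *)

Section FreeGroup.
Variable X : Type.

Definition word : Type := seq (X * bool).
HB.instance Definition _ := gen_eqMixin word.
HB.instance Definition _ := gen_choiceMixin word.

Inductive free_eq : word -> word -> Prop :=
| free_cancel (u v : word) x e :
    free_eq (u ++ (x, e) :: (x, ~~ e) :: v) (u ++ v)
| free_refl u : free_eq u u
| free_sym u v : free_eq u v -> free_eq v u
| free_trans v u w : free_eq u v -> free_eq v w -> free_eq u w.

Definition free_eqb : rel word := fun u v => `[< free_eq u v >].

Lemma free_eqb_refl : reflexive free_eqb.
Proof. by move=> u; apply/asboolP; apply: free_refl. Qed.
Lemma free_eqb_sym : symmetric free_eqb.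
Proof. by move=> u v; apply/asboolP/asboolP; apply: free_sym. Qed.
Lemma free_eqb_trans : transitive free_eqb.
Proof.
move=> v u w /asboolP uv /asboolP vw; apply/asboolP; exact: free_trans vw.
Qed.
Canonical free_equiv :=
  EquivRel free_eqb free_eqb_refl free_eqb_sym free_eqb_trans.

Definition free_group : Type := {eq_quot free_equiv}.
HB.instance Definition _ := Choice.on free_group.
HB.instance Definition _ := Quotient.on free_group.
HB.instance Definition _ := EqQuotient.on free_group.

Definition word_inv (u : word) : word := rev [seq (l.1, ~~ l.2) | l <- u].

Lemma free_piP (u v : word) :
  \pi_free_group u = \pi_free_group v <-> free_eq u v.
Proof.
by split=> [/(@eqmodP _ free_equiv)/asboolP//|uv]; apply/eqmodP/asboolP.
Qed.

Lemma free_eq_cat u u' v v' :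
  free_eq u u' -> free_eq v v' -> free_eq (u ++ v) (u' ++ v').
Proof.
move=> uu' vv'; apply: (@free_trans (u' ++ v)).
  elim: uu' => [w1 w2 x e|w|w1 w2 _|w2 w1 w3 _ IH1 _ IH2].
  - by rewrite -!catA; apply: free_cancel.
  - exact: free_refl.
  - exact: free_sym.
  - exact: free_trans IH2.
elim: vv' => [w1 w2 x e|w|w1 w2 _|w2 w1 w3 _ IH1 _ IH2].
- by rewrite !catA; apply: free_cancel.
- exact: free_refl.
- exact: free_sym.
- exact: free_trans IH2.
Qed.

Lemma free_eq_inv u v : free_eq u v -> free_eq (word_inv u) (word_inv v).
Proof.
elim=> [w1 w2 x e|w|w1 w2 _|w2 w1 w3 _ IH1 _ IH2].
- rewrite /word_inv !map_cat /= !rev_cat !rev_cons negbK -!cats1 -!catA /=.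
  exact: free_cancel.
- exact: free_refl.
- exact: free_sym.
- exact: free_trans IH2.
Qed.

Lemma free_eq_mulV u : free_eq (u ++ word_inv u) [::].
Proof.
elim: u => [|[x e] u IH]; first exact: free_refl.
have -> : ((x, e) :: u) ++ word_inv ((x, e) :: u) =
    [:: (x, e)] ++ (u ++ word_inv u) ++ [:: (x, ~~ e)].
  by rewrite /word_inv map_cons rev_cons -cats1 -catA.
apply: (@free_trans ([:: (x, e)] ++ [::] ++ [:: (x, ~~ e)])).
  by do !apply: free_eq_cat => //; apply: free_refl.
exact: (@free_cancel [::] [::]).
Qed.

Lemma word_invK : involutive word_inv.
Proof.
move=> u; rewrite /word_inv map_rev revK -map_comp.
by rewrite (@eq_map _ _ _ id) ?map_id // => -[x e] /=; rewrite negbK.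
Qed.

Definition free_one : free_group := \pi_free_group [::].
Definition free_mul (x y : free_group) : free_group :=
  \pi_free_group (repr x ++ repr y).
Definition free_inv (x : free_group) : free_group :=
  \pi_free_group (word_inv (repr x)).

Lemma free_repr (u : word) : free_eq (repr (\pi_free_group u)) u.
Proof. by apply/free_piP; rewrite reprK. Qed.

Lemma free_mulA : associative free_mul.
Proof.
move=> x y z; apply/free_piP; apply: (@free_trans (repr x ++ repr y ++ repr z)).
  by apply: free_eq_cat; [apply: free_refl|apply: free_repr].
rewrite catA; apply: free_sym.
by apply: free_eq_cat; [apply: free_repr|apply: free_refl].
Qed.

Lemma free_mul1g : left_id free_one free_mul.
Proof.
move=> x; rewrite -[RHS]reprK; apply/free_piP.
exact: (free_eq_cat (free_repr [::]) (free_refl (repr x))).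
Qed.

Lemma free_mulg1 : right_id free_one free_mul.
Proof.
move=> x; rewrite -[RHS]reprK; apply/free_piP.
by rewrite -[X in free_eq _ X]cats0;
  apply: free_eq_cat (free_refl _) (free_repr _).
Qed.

Lemma free_mulgV : right_inverse free_one free_inv free_mul.
Proof.
move=> x; apply/free_piP; apply: (@free_trans (repr x ++ word_inv (repr x))).
  exact: free_eq_cat (free_refl _) (free_repr _).
exact: free_eq_mulV.
Qed.

Lemma free_mulVg : left_inverse free_one free_inv free_mul.
Proof.
move=> x; apply/free_piP; apply: (@free_trans (word_inv (repr x) ++ repr x)).
  exact: free_eq_cat (free_repr _) (free_refl _).
by rewrite -[X in _ ++ X]word_invK; apply: free_eq_mulV.
Qed.

HB.instance Definition _ := isGroup.Build free_group
  free_mulA free_mul1g free_mulg1 free_mulVg free_mulgV.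

Definition free_gen (x : X) : free_group := \pi_free_group [:: (x, true)].

End FreeGroup.

(* The group < X | u = v for all u, v with R u v >: the quotient of the free
   group by the least congruence containing R. *)

Section Presented.
Variables (X : Type) (R : free_group X -> free_group X -> Prop).

Inductive pres_eq : free_group X -> free_group X -> Prop :=
| pres_rel u v : R u v -> pres_eq u v
| pres_mul u u' v v' : pres_eq u u' -> pres_eq v v' -> pres_eq (u * v) (u' * v')
| pres_refl u : pres_eq u u
| pres_sym u v : pres_eq u v -> pres_eq v u
| pres_trans v u w : pres_eq u v -> pres_eq v w -> pres_eq u w.

Definition pres_eqb : rel (free_group X) := fun u v => `[< pres_eq u v >].

Lemma pres_eqb_refl : reflexive pres_eqb.
Proof. by move=> u; apply/asboolP; apply: pres_refl. Qed.
Lemma pres_eqb_sym : symmetric pres_eqb.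
Proof. by move=> u v; apply/asboolP/asboolP; apply: pres_sym. Qed.
Lemma pres_eqb_trans : transitive pres_eqb.
Proof.
move=> v u w /asboolP uv /asboolP vw; apply/asboolP; exact: pres_trans vw.
Qed.
Canonical pres_equiv :=
  EquivRel pres_eqb pres_eqb_refl pres_eqb_sym pres_eqb_trans.

Definition presented : Type := {eq_quot pres_equiv}.
HB.instance Definition _ := Choice.on presented.
HB.instance Definition _ := Quotient.on presented.
HB.instance Definition _ := EqQuotient.on presented.

Lemma pres_piP (u v : free_group X) :
  \pi_presented u = \pi_presented v <-> pres_eq u v.
Proof.
by split=> [/(@eqmodP _ pres_equiv)/asboolP//|uv]; apply/eqmodP/asboolP.
Qed.

Lemma pres_repr (u : free_group X) : pres_eq (repr (\pi_presented u)) u.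
Proof. by apply/pres_piP; rewrite reprK. Qed.

Lemma pres_eq_inv u v : pres_eq u v -> pres_eq u^-1 v^-1.
Proof.
move=> uv; rewrite -[u^-1]mulg1 -(mulgV v) -[X in pres_eq _ X]mul1g -(mulVg u).
rewrite mulgA; apply: pres_mul (pres_refl _); apply: pres_mul (pres_refl _) _.
exact: pres_sym.
Qed.

Definition presented_one : presented := \pi_presented 1.
Definition presented_mul (x y : presented) : presented :=
  \pi_presented (repr x * repr y).
Definition presented_inv (x : presented) : presented :=
  \pi_presented ((repr x)^-1).

Lemma presented_mulA : associative presented_mul.
Proof.
move=> x y z; apply/pres_piP; apply: (@pres_trans (repr x * (repr y * repr z))).
  by apply: pres_mul; [apply: pres_refl|apply: pres_repr].
rewrite mulgA; apply: pres_sym.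
by apply: pres_mul; [apply: pres_repr|apply: pres_refl].
Qed.

Lemma presented_mul1g : left_id presented_one presented_mul.
Proof.
move=> x; rewrite -[RHS]reprK -[in RHS](mul1g (repr x)); apply/pres_piP.
exact: pres_mul (pres_repr _) (pres_refl _).
Qed.

Lemma presented_mulg1 : right_id presented_one presented_mul.
Proof.
move=> x; rewrite -[RHS]reprK -[in RHS](mulg1 (repr x)); apply/pres_piP.
exact: pres_mul (pres_refl _) (pres_repr _).
Qed.

Lemma presented_mulgV : right_inverse presented_one presented_inv presented_mul.
Proof.
move=> x; apply/pres_piP; rewrite -(mulgV (repr x)).
exact: pres_mul (pres_refl _) (pres_repr _).
Qed.

Lemma presented_mulVg : left_inverse presented_one presented_inv presented_mul.
Proof.
move=> x; apply/pres_piP; rewrite -(mulVg (repr x)).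
exact: pres_mul (pres_repr _) (pres_refl _).
Qed.

HB.instance Definition _ := isGroup.Build presented
  presented_mulA presented_mul1g presented_mulg1
  presented_mulVg presented_mulgV.

Definition pres_gen (x : X) : presented := \pi_presented (free_gen x).

End Presented.

(* G is presented by the generators g x (x : X) and the defining relations R:
   the map from < X | R > to G sending each generator x to g x is well defined
   and an isomorphism. *)
Definition has_presentation (X : Type) (G : groupType) (g : X -> G)
    (R : free_group X -> free_group X -> Prop) : Prop :=
  exists f : {multiplicative presented R -> G},
    bijective f /\ forall x, f (pres_gen R x) = g x.

Definition finitely_presented (G : groupType) : Prop :=
  exists (m : nat) (g : 'I_m -> G)
         (rs : seq (free_group 'I_m * free_group 'I_m)),
    has_presentation g (fun u v => (u, v) \in rs).

Section Derived.
Variable G : groupType.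

Inductive in_derived : G -> Prop :=
| in_derived_comm x y : in_derived [~ x, y]
| in_derived1 : in_derived 1
| in_derivedM x y : in_derived x -> in_derived y -> in_derived (x * y)
| in_derivedV x : in_derived x -> in_derived x^-1.

Definition derived_pred : pred G := fun x => `[< in_derived x >].

Lemma derived_group_closed : group_closed derived_pred.
Proof.
split; first by apply/asboolP; apply: in_derived1.
move=> x y /asboolP dx /asboolP dy; apply/asboolP.
by apply: in_derivedM => //; apply: in_derivedV.
Qed.

Definition derived : Type := {x : G | derived_pred x}.
HB.instance Definition _ := SubChoice.on derived.
HB.instance Definition _ :=
  SubChoice_isSubGroup.Build G derived_pred derived derived_group_closed.

End Derived.

Definition interval (lo hi : nat) : Type := {i : nat | lo <= i <= hi}.

(* Lets a family with indices lo, ..., hi be written g_i for a natural number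
   i; the junk value 1 outside this range does not occur below when 6 <= n. *)
Definition at_index lo hi (G : groupType) (g : interval lo hi -> G)
    (i : nat) : G :=
  oapp g 1 (insub i).

(* Meaningful for n = 6, 7, 8: the Coxeter diagram is the path a_1, ..., a_(n-1)
   with a_n attached to a_3. *)
Section ArtinE.
Variable n : nat.

Let a : nat -> free_group (interval 1 n) := at_index (@free_gen (interval 1 n)).

Inductive artinE_rel :
  free_group (interval 1 n) -> free_group (interval 1 n) -> Prop :=
| artinE_comm i j : 1 <= i -> i < j -> j <= n - 1 -> 2 <= j - i ->
    artinE_rel (a i * a j) (a j * a i)
| artinE_comm_last i : 1 <= i <= n - 1 -> i != 3 ->
    artinE_rel (a i * a n) (a n * a i)
| artinE_braid i : 1 <= i <= n - 2 ->
    artinE_rel (a i * a i.+1 * a i) (a i.+1 * a i * a i.+1)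
| artinE_braid_last :
    artinE_rel (a 3 * a n * a 3) (a n * a 3 * a n).

Definition artinE : groupType := presented artinE_rel.

Definition artinE_gen : nat -> artinE := at_index (pres_gen artinE_rel).

End ArtinE.

Inductive derivedE_index (n : nat) : Type :=
| Ip0 | Ip1 | Ib | Iq of interval 3 n.

Section DerivedE.
Variable n : nat.

Let a : nat -> artinE n := @artinE_gen n.

Definition derivedE_elt (x : derivedE_index n) : artinE n :=
  match x with
  | Ip0 => a 2 * (a 1)^-1
  | Ip1 => a 1 * a 2 * (a 1) ^- 2
  | Ib => a 2 * (a 1)^-1 * a 3 * (a 2)^-1
  | Iq l => a (val l) * (a 1)^-1
  end.

Local Notation F := (free_group (derivedE_index n)).
Let p0 : F := free_gen (Ip0 n).
Let p1 : F := free_gen (Ip1 n).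
Let b : F := free_gen (Ib n).
Let q : nat -> F := at_index (fun l : interval 3 n => free_gen (Iq l)).

Inductive derivedE_rel : F -> F -> Prop :=
| dE_b : derivedE_rel b (p0 * q 3 * p0^-1)
| dE_p0b : derivedE_rel (p0 * b * p0^-1) (b ^+ 2 * (q 3)^-1 * b)
| dE_p1q3 : derivedE_rel (p1 * q 3 * p1^-1) ((q 3)^-1 * b)
| dE_p1b : derivedE_rel (p1 * b * p1^-1)
    (((q 3)^-1 * b) ^+ 3 * (q 3) ^- 2 * b)
| dE_p0q j : 4 <= j <= n -> derivedE_rel (p0 * q j) (q j * p1)
| dE_p1q j : 4 <= j <= n -> derivedE_rel (p1 * q j) (q j * p0^-1 * p1)
| dE_qbraid i : 3 <= i <= n - 2 ->
    derivedE_rel (q i * q i.+1 * q i) (q i.+1 * q i * q i.+1)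
| dE_qbraid_last : derivedE_rel (q n * q 3 * q n) (q 3 * q n * q 3)
| dE_qcomm i j : 3 <= i -> i < j -> j <= n - 1 -> 2 <= j - i ->
    derivedE_rel (q i * q j) (q j * q i)
| dE_qcomm_last i : 4 <= i <= n - 1 -> derivedE_rel (q i * q n) (q n * q i).

End DerivedE.

(* Main.v *)
(* Let P be the group with the listed presentation. Conjugation by a_1 suggests
   the automorphism phi of P given by p0 |-> p1, p1 |-> p0^-1 p1,
   b |-> q3^-1 b and q_l |-> q_l. Letting a_1 act on the set P by phi, and a_2
   and a_l by phi followed by left multiplication by p0 and q_l, satisfies the
   Artin relations, and pulled back along the map P -> A it is the left regular
   action of P, so P -> A is injective. Its image is normalised by a_1 and
   contains every a_l a_1^-1, hence is normal with cyclic quotient, so it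
   contains A'; the braid relations give the reverse inclusion. *)
From HB Require Import structures.
From mathcomp Require Import all_boot.
From mathcomp Require Import boolp zify.
Require Import Defs.

Set Implicit Arguments.
Unset Strict Implicit.
Unset Printing Implicit Defensive.

Local Open Scope group_scope.
Local Open Scope quotient_scope.

(** * Presented groups *)

Section FreeLift.
Variables (X : Type) (H : groupType) (h : X -> H).

Definition word_eval (w : word X) : H :=
  foldr (fun l x => (if l.2 then h l.1 else (h l.1)^-1) * x) 1 w.

Lemma word_eval_cat u v : word_eval (u ++ v) = word_eval u * word_eval v.
Proof. by elim: u => [|l u IHu] /=; rewrite ?mul1g // IHu mulgA. Qed.

Lemma word_eval_free_eq u v : free_eq u v -> word_eval u = word_eval v.
Proof.
elim=> [w1 w2 x e|//|w1 w2 _ -> //|w2 w1 w3 _ -> _ -> //].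
rewrite !word_eval_cat /=; congr (_ * _).
by case: e => /=; rewrite ?mulKg ?mulVKg.
Qed.

Definition free_lift (x : free_group X) : H := word_eval (repr x).

Lemma free_lift_pi (w : word X) :
  free_lift (\pi_(free_group X) w) = word_eval w.
Proof. exact/word_eval_free_eq/free_repr. Qed.

Lemma free_lift_morphism : monoid_morphism free_lift.
Proof.
split; first by rewrite -[1]/(free_one X) free_lift_pi.
by move=> x y; rewrite -[x * y]/(free_mul x y) free_lift_pi word_eval_cat.
Qed.

HB.instance Definition _ :=
  isUMagmaMorphism.Build (free_group X) H free_lift free_lift_morphism.

Lemma free_lift_gen x : free_lift (free_gen x) = h x.
Proof. by rewrite free_lift_pi /= mulg1. Qed.

Lemma free_lift_at_index lo hi (g : interval lo hi -> free_group X) i :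
  free_lift (at_index g i) = at_index (free_lift \o g) i.
Proof. by rewrite /at_index; case: insub => [l|] //=; apply: gmulf1. Qed.

End FreeLift.

Lemma free_group_ind (X : Type) (K : free_group X -> Prop) :
  K 1 -> (forall x, K (free_gen x)) ->
  (forall x y, K x -> K y -> K (x * y)) -> (forall x, K x -> K x^-1) ->
  forall x, K x.
Proof.
move=> K1 Kgen KM KV x; rewrite -[x]reprK.
elim: (repr x) => [|[y e] w IHw]; first exact: K1.
have -> : \pi_(free_group X) ((y, e) :: w) =
    (if e then free_gen y else (free_gen y)^-1) * \pi_(free_group X) w.
  have -> : (if e then free_gen y else (free_gen y)^-1) =
      \pi_(free_group X) [:: (y, e)].
    (* Inversion in [free_group] inverts a chosen representative of the class, so for [e = false]
       the two words agree only up to [free_eq]. *)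
    case: e => //; apply/free_piP.
    apply: (@free_trans _ (word_inv [:: (y, true)])); last exact: free_refl.
    by apply: free_eq_inv; apply: free_repr.
  apply/free_piP; rewrite -cat1s; apply/free_sym.
  by apply: free_eq_cat; apply: free_repr.
by apply: KM => //; case: e; [|apply: KV].
Qed.

Lemma free_hom_ext (X : Type) (H : groupType)
    (f g : UMagmaMorphism.type (free_group X) H) :
  (forall x, f (free_gen x) = g (free_gen x)) -> f =1 g.
Proof.
move=> fg; apply: free_group_ind => // [|x y fgx fgy|x fgx].
- by rewrite !gmulf1.
- by rewrite !gmulfM fgx fgy.
- by rewrite !gmulfV fgx.
Qed.

Definition respects (X : Type) (R : free_group X -> free_group X -> Prop)
    (H : groupType) (h : X -> H) : Prop :=
  forall u v, R u v -> free_lift h u = free_lift h v.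

Section PresentedLift.
Variables (X : Type) (R : free_group X -> free_group X -> Prop).

Definition pres_pi (u : free_group X) : presented R := \pi u.

Lemma pres_pi_repr x : pres_pi (repr x) = x.
Proof. exact: reprK. Qed.

Lemma pres_pi_morphism : monoid_morphism pres_pi.
Proof.
split=> // x y; apply/pres_piP/pres_sym.
exact: pres_mul (pres_repr _ _) (pres_repr _ _).
Qed.

HB.instance Definition _ :=
  isUMagmaMorphism.Build (free_group X) (presented R) pres_pi pres_pi_morphism.

Lemma free_lift_pres_gen u : free_lift (pres_gen R) u = pres_pi u.
Proof. by apply: free_hom_ext => x /=; rewrite free_lift_gen. Qed.

Lemma respects_pres_gen : respects R (pres_gen R).
Proof.
by move=> u v Ruv; rewrite !free_lift_pres_gen; apply/pres_piP/pres_rel.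
Qed.

Lemma presented_ind (K : presented R -> Prop) :
  K 1 -> (forall x, K (pres_gen R x)) ->
  (forall x y, K x -> K y -> K (x * y)) -> (forall x, K x -> K x^-1) ->
  forall x, K x.
Proof.
move=> K1 Kgen KM KV x; rewrite -[x]pres_pi_repr.
elim/free_group_ind: (repr x) => [//|//|u v Ku Kv|u Ku].
- by rewrite gmulfM; apply: KM.
- by rewrite gmulfV; apply: KV.
Qed.

Lemma pres_hom_ext (H : groupType)
    (f g : UMagmaMorphism.type (presented R) H) :
  (forall x, f (pres_gen R x) = g (pres_gen R x)) -> f =1 g.
Proof.
move=> fg; apply: presented_ind => // [|x y fgx fgy|x fgx].
- by rewrite !gmulf1.
- by rewrite !gmulfM fgx fgy.
- by rewrite !gmulfV fgx.
Qed.

Section Lift.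
Variables (H : groupType) (h : X -> H) (hR : respects R h).

(** Carrying the proof of [respects R h] as an argument lets the morphism structure below be
    attached to [pres_lift hR]. *)
Definition pres_lift of respects R h := fun x : presented R =>
  free_lift h (repr x).

Lemma free_lift_pres_eq u v : pres_eq R u v -> free_lift h u = free_lift h v.
Proof.
elim=> [|u1 u2 v1 v2 _ IHu _ IHv|//|//|u2 u1 u3 _ -> _ -> //]; first exact: hR.
by rewrite !gmulfM /= IHu IHv.
Qed.

Lemma pres_lift_pi u : pres_lift hR (pres_pi u) = free_lift h u.
Proof. exact/free_lift_pres_eq/pres_repr. Qed.

Lemma pres_lift_morphism : monoid_morphism (pres_lift hR).
Proof.
split=> [|x y].
  by rewrite -[1 in LHS]/(pres_pi 1) pres_lift_pi gmulf1.
rewrite -[x in LHS]pres_pi_repr -[y in LHS]pres_pi_repr -gmulfM pres_lift_pi.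
exact: gmulfM.
Qed.

HB.instance Definition _ :=
  isUMagmaMorphism.Build (presented R) H (pres_lift hR) pres_lift_morphism.

Lemma pres_lift_gen x : pres_lift hR (pres_gen R x) = h x.
Proof. by rewrite pres_lift_pi free_lift_gen. Qed.

End Lift.
End PresentedLift.

(** The relations are carried along [e] to words over ['I_m]; [e] and its inverse then extend to
    mutually inverse homomorphisms between the two presented groups. *)
Lemma has_presentation_finite (X : Type) (G : groupType) (g : X -> G)
    (R : free_group X -> free_group X -> Prop) (m : nat) (e : X -> 'I_m)
    (L : seq (free_group X * free_group X)) :
  bijective e -> (forall u v, R u v -> (u, v) \in L) ->
  has_presentation g R -> finitely_presented G.
Proof.
move=> [d eK dK] RL [f [f_bij f_gen]].
pose rename : free_group X -> free_group 'I_m :=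
  free_lift (fun x => free_gen (e x)).
(* [L] may contain pairs outside [R]; deciding [R] classically cuts it down to exactly the
   relations. *)
pose rs := [seq r <- L | `[< R r.1 r.2 >]].
have Rrs u v : R u v <-> (u, v) \in rs.
  rewrite mem_filter; split=> [Ruv|/andP[/asboolP//]].
  by rewrite RL // andbT; apply/asboolP.
pose rs' := [seq (rename r.1, rename r.2) | r <- rs].
pose R' u v := (u, v) \in rs'.
have rename_lift (H : groupType) (h : 'I_m -> H) u :
    free_lift h (rename u) = free_lift (h \o e) u.
  rewrite -[LHS]/((free_lift h \o rename) u).
  by apply: free_hom_ext => x /=; rewrite !free_lift_gen.
have to_resp : respects R (pres_gen R' \o e).
  move=> u v /Rrs uv; rewrite -!rename_lift; apply: respects_pres_gen.
  by apply/mapP; exists (u, v).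
have of_resp : respects R' (pres_gen R \o d).
  move=> u' v' /mapP[[u v] /Rrs Ruv [-> ->]]; rewrite !rename_lift.
  have <- : pres_gen R = (pres_gen R \o d) \o e.
    by apply/funext => x /=; rewrite eK.
  exact: respects_pres_gen.
have toK : cancel (pres_lift to_resp) (pres_lift of_resp).
  move=> z; rewrite -[LHS]/((pres_lift of_resp \o pres_lift to_resp) z).
  rewrite -[RHS]/(idfun z).
  by apply: pres_hom_ext => x /=; do !rewrite pres_lift_gen /=; rewrite eK.
have ofK : cancel (pres_lift of_resp) (pres_lift to_resp).
  move=> z; rewrite -[LHS]/((pres_lift to_resp \o pres_lift of_resp) z).
  rewrite -[RHS]/(idfun z).
  by apply: pres_hom_ext => x /=; do !rewrite pres_lift_gen /=; rewrite dK.
exists m, (g \o d), rs'.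
exists (f \o pres_lift of_resp : {multiplicative _ -> _}); split.
  apply: bij_comp => //; exact: Bijective ofK toK.
by move=> i /=; rewrite pres_lift_gen f_gen.
Qed.

(** * Normal subgroups modulo which all generators agree *)

Section CommutatorsModulo.
Variables (X : Type) (R : free_group X -> free_group X -> Prop).
Variables (N : presented R -> Prop) (x0 : X).
Hypotheses (N1 : N 1) (NM : forall x y, N x -> N y -> N (x * y)).
Hypotheses (NV : forall x, N x -> N x^-1).
Hypothesis NJ : forall x y, N x -> N (y * x * y^-1).
Hypothesis N_gen : forall x, N (pres_gen R x * (pres_gen R x0)^-1).

(** By normality of [N], the elements commuting with [y] modulo [N] are closed under products and
    inverses, and every generator equals the one at [x0] modulo [N]. It is applied first with [y]
    the generator at [x0], where the hypothesis is trivial, then with arbitrary [y]. *)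
Lemma commute_modulo_ind y :
  N (pres_gen R x0 * y * (pres_gen R x0)^-1 * y^-1) ->
  forall x, N (x * y * x^-1 * y^-1).
Proof.
move=> Nty; elim/presented_ind => [|x|x x' Nx Nx'|x Nx].
- by rewrite !gnorm.
- by have := NM (NM (N_gen x) Nty) (NJ y (NV (N_gen x))); rewrite !gnorm.
- by have := NM (NJ x Nx') Nx; rewrite !gnorm.
- by have := NJ x^-1 (NV Nx); rewrite !gnorm.
Qed.

(* Modulo N all generators agree, so the quotient by N is cyclic. *)
Lemma in_derived_modulo x : in_derived x -> N x.
Proof.
elim=> [{}x y|//|y z _ Ny _|y _ Ny]; [|exact: NM|exact: NV].
have Ntx z : N (pres_gen R x0 * z * (pres_gen R x0)^-1 * z^-1).
  rewrite -[X in N X]invgK; apply: NV.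
  have := @commute_modulo_ind (pres_gen R x0) _ z.
  by rewrite !gnorm; apply.
by have := commute_modulo_ind (Ntx y^-1) x^-1; rewrite /commg /conjg !gnorm.
Qed.

End CommutatorsModulo.

(** * Groups of bijections *)

(** Storing the inverse map makes group inversion an exchange of fields. *)
Record bijection (T : Type) := Bijection {
  bij_fun : T -> T;
  bij_inv : T -> T;
  bij_funK : cancel bij_fun bij_inv;
  bij_invK : cancel bij_inv bij_fun }.

Section BijectionGroup.
Variable T : Type.
HB.instance Definition _ := gen_eqMixin (bijection T).
HB.instance Definition _ := gen_choiceMixin (bijection T).

(** The forward map determines its inverse, and the two cancellation proofs are equal by proof
    irrelevance. *)
Lemma bijection_ext (s t : bijection T) : bij_fun s =1 bij_fun t -> s = t.
Proof.
case: s t => [f f' fK f'K] [g g' gK g'K] /= /funext fg.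
rewrite fg in fK f'K *.
have f'g' : f' = g' by apply/funext => x; rewrite -[x in LHS]g'K fK.
by rewrite f'g' in fK f'K *; congr Bijection; apply: Prop_irrelevance.
Qed.

Definition bijection1 : bijection T := @Bijection T id id (@erefl T) (@erefl T).
(** The factor [t] is applied first, so that left multiplication is a homomorphism rather than an
    antihomomorphism. *)
Definition bijectionM (s t : bijection T) : bijection T :=
  Bijection (can_comp (bij_funK s) (bij_funK t))
    (can_comp (bij_invK t) (bij_invK s)).
Definition bijectionV (s : bijection T) : bijection T :=
  Bijection (bij_invK s) (bij_funK s).

Lemma bijectionA : associative bijectionM.
Proof. by move=> s t u; apply: bijection_ext. Qed.
Lemma bijection1M : left_id bijection1 bijectionM.
Proof. by move=> s; apply: bijection_ext. Qed.
Lemma bijectionM1 : right_id bijection1 bijectionM.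
Proof. by move=> s; apply: bijection_ext. Qed.
Lemma bijectionVM : left_inverse bijection1 bijectionV bijectionM.
Proof. by move=> s; apply: bijection_ext => x; apply: bij_funK. Qed.
Lemma bijectionMV : right_inverse bijection1 bijectionV bijectionM.
Proof. by move=> s; apply: bijection_ext => x; apply: bij_invK. Qed.

HB.instance Definition _ := isGroup.Build (bijection T)
  bijectionA bijection1M bijectionM1 bijectionVM bijectionMV.
End BijectionGroup.

(** * The left regular representation *)

Section LeftRegular.
Variable G : groupType.

Definition lmul (x : G) : bijection G := Bijection (mulKg x) (mulVKg x).

Lemma lmul_morphism : monoid_morphism lmul.
Proof.
split=> [|x y]; apply: bijection_ext => z /=; first exact: mul1g.
by rewrite mulgA.
Qed.

HB.instance Definition _ :=
  isUMagmaMorphism.Build G (bijection G) lmul lmul_morphism.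

Lemma lmul_inj : injective lmul.
Proof.
by move=> x y /(congr1 (fun s => bij_fun s 1)) /=; rewrite !mulg1.
Qed.

End LeftRegular.
Arguments lmul {G} x.

(** * The two systems of relations in an arbitrary group *)

Lemma at_indexE lo hi (G : groupType) (f : nat -> G) i :
  lo <= i <= hi -> at_index (fun l : interval lo hi => f (val l)) i = f i.
Proof. by move=> ihi; rewrite /at_index (insubT (fun k => lo <= k <= hi)). Qed.

Record artinE_relations (n : nat) (H : groupType) (a : nat -> H) : Prop :=
  ArtinERelations {
    aE_comm : forall i j, 1 <= i -> i < j -> j <= n - 1 -> 2 <= j - i ->
      a i * a j = a j * a i;
    aE_comm_last : forall i, 1 <= i <= n - 1 -> i != 3 -> a i * a n = a n * a i;
    aE_braid : forall i, 1 <= i <= n - 2 ->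
      a i * a i.+1 * a i = a i.+1 * a i * a i.+1;
    aE_braid_last : a 3 * a n * a 3 = a n * a 3 * a n }.

Record derivedE_relations (n : nat) (H : groupType) (p0 p1 b : H)
    (q : nat -> H) : Prop := DerivedERelations {
  rE_b : b = p0 * q 3 * p0^-1;
  rE_p0b : p0 * b * p0^-1 = b ^+ 2 * (q 3)^-1 * b;
  rE_p1q3 : p1 * q 3 * p1^-1 = (q 3)^-1 * b;
  rE_p1b : p1 * b * p1^-1 = ((q 3)^-1 * b) ^+ 3 * (q 3) ^- 2 * b;
  rE_p0q : forall j, 4 <= j <= n -> p0 * q j = q j * p1;
  rE_p1q : forall j, 4 <= j <= n -> p1 * q j = q j * p0^-1 * p1;
  rE_qbraid : forall i, 3 <= i <= n - 2 ->
    q i * q i.+1 * q i = q i.+1 * q i * q i.+1;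
  rE_qbraid_last : q n * q 3 * q n = q 3 * q n * q 3;
  rE_qcomm : forall i j, 3 <= i -> i < j -> j <= n - 1 -> 2 <= j - i ->
    q i * q j = q j * q i;
  rE_qcomm_last : forall i, 4 <= i <= n - 1 -> q i * q n = q n * q i }.

(** Left to right, this reads off the relations that hold in the presented group; right to left, it
    supplies the hypothesis of [pres_lift]. *)
Lemma respects_artinE n (H : groupType) (h : interval 1 n -> H) :
  respects (@artinE_rel n) h <-> artinE_relations n (at_index h).
Proof.
have gen i : free_lift h (at_index (@free_gen (interval 1 n)) i) = at_index h i.
  rewrite free_lift_at_index; congr at_index.
  by apply/funext => x /=; rewrite free_lift_gen.
split=> [hR|[c cl br brl] u v].
  split=> [i j i1 ij jn ji|i i1 i3|i i1|].
  - by have := hR _ _ (artinE_comm i1 ij jn ji); rewrite !gmulfM /= !gen.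
  - by have := hR _ _ (artinE_comm_last i1 i3); rewrite !gmulfM /= !gen.
  - by have := hR _ _ (artinE_braid i1); rewrite !gmulfM /= !gen.
  - by have := hR _ _ (artinE_braid_last n); rewrite !gmulfM /= !gen.
case=> *; rewrite !gmulfM /= !gen; by [apply: c|apply: cl|apply: br|apply: brl].
Qed.

Lemma respects_derivedE n (H : groupType) (h : derivedE_index n -> H) :
  respects (@derivedE_rel n) h <->
  derivedE_relations n (h (Ip0 n)) (h (Ip1 n)) (h (Ib n))
    (at_index (fun l : interval 3 n => h (Iq l))).
Proof.
have gen i : free_lift h (at_index (fun l : interval 3 n => free_gen (Iq l)) i)
    = at_index (fun l : interval 3 n => h (Iq l)) i.
  rewrite free_lift_at_index; congr at_index.
  by apply/funext => x /=; rewrite free_lift_gen.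
pose liftE := (gmulfM, gmulfV, gmulfXn).
split=> [hR|hR u v].
  split=> [||||j jn|j jn|i i3||i j i3 ij jn ji|i i4].
  - by have := hR _ _ (dE_b n); rewrite !liftE /= !gen !free_lift_gen.
  - by have := hR _ _ (dE_p0b n); rewrite !liftE /= !gen !free_lift_gen.
  - by have := hR _ _ (dE_p1q3 n); rewrite !liftE /= !gen !free_lift_gen.
  - by have := hR _ _ (dE_p1b n); rewrite !liftE /= !gen !free_lift_gen.
  - by have := hR _ _ (dE_p0q jn); rewrite !liftE /= !gen !free_lift_gen.
  - by have := hR _ _ (dE_p1q jn); rewrite !liftE /= !gen !free_lift_gen.
  - by have := hR _ _ (dE_qbraid i3); rewrite !liftE /= !gen.
  - by have := hR _ _ (dE_qbraid_last n); rewrite !liftE /= !gen.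
  - by have := hR _ _ (dE_qcomm i3 ij jn ji); rewrite !liftE /= !gen.
  - by have := hR _ _ (dE_qcomm_last i4); rewrite !liftE /= !gen.
case: hR => e1 e2 e3 e4 e5 e6 e7 e8 e9 e10.
by case=> *; rewrite !liftE /= !gen ?free_lift_gen; auto.
Qed.

(** In this form [conjMg], [conjVg] and [conjXg] distribute conjugation over words. *)
Lemma conjgVE (G : groupType) (x y : G) : y * x * y^-1 = x ^ y^-1.
Proof. by rewrite /conjg invgK mulgA. Qed.

Lemma derivedE_relations_hom n (H K : groupType) (f : UMagmaMorphism.type H K)
    (p0 p1 b : H) (q : nat -> H) :
  derivedE_relations n p0 p1 b q ->
  derivedE_relations n (f p0) (f p1) (f b) (f \o q).
Proof.
case=> eb e0 e1 e1b e0q e1q br brl c cl.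
split=> [||||j jn|j jn|i i3||i j i3 ij jn ji|i i4] /=;
  rewrite -?(gmulfM, gmulfV, gmulfXn); congr (f _) => //.
- exact: e0q.
- exact: e1q.
- exact: br.
- exact: c.
- exact: cl.
Qed.

(** * Invariance of the relations under phi and its inverse, and passage between the two systems *)

Section Relations.
Variables (n : nat) (H : groupType).

Let expE := (@expgS H, @expg0 H).

(** Makes phi well defined. The relations express the conjugates of [q 3] and [b] by [p0] and by
    [p1] as words in [q 3] and [b]; a conjugation by [p0^-1 * p1] is checked after moving its [p0]
    part to the other side. *)
Lemma derivedE_relations_shift (p0 p1 b : H) (q : nat -> H) :
  derivedE_relations n p0 p1 b q ->
  derivedE_relations n p1 (p0^-1 * p1) ((q 3)^-1 * b) q.
Proof.
case; rewrite !conjgVE => eb e0 e1 e1b e0q e1q br brl c cl.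
have shift x : x ^ (p0^-1 * p1)^-1 = (x ^ p1^-1) ^ p0.
  by rewrite invgM invgK conjgM.
split=> //; rewrite ?conjgVE ?shift //.
- by rewrite conjMg conjVg e1 e1b !expE !gnorm.
- apply: (canLR (conjgKV _)).
  by rewrite e1 !conjMg !conjVg -eb e0 !expE !gnorm.
- apply: (canLR (conjgKV _)).
  by rewrite !(conjMg, conjVg, conjXg) e1 e1b -eb e0 !expE !gnorm.
- by move=> j jn; rewrite e1q // mulgA.
- move=> j jn; apply: (mulgI p0); rewrite -mulgA mulVKg e1q //.
  by rewrite !mulgA e0q // !gnorm.
Qed.

(** Makes the inverse of phi well defined. Conjugation by [p1] now has to be undone, so its inverse
    on [q 3] and [b] is computed first. *)
Lemma derivedE_relations_unshift (p0 p1 b : H) (q : nat -> H) :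
  derivedE_relations n p0 p1 b q ->
  derivedE_relations n (p0 * p1^-1) p0 (q 3 * b) q.
Proof.
case; rewrite !conjgVE => eb e0 e1 e1b e0q e1q br brl c cl.
have unshift x : x ^ (p0 * p1^-1)^-1 = (x ^ p1) ^ p0^-1.
  by rewrite invgM invgK conjgM.
(* The word on the right is found by solving the formulas for [p1 * q 3 * p1^-1] and
   [p1 * b * p1^-1] for [q 3]. *)
have q3p1 : q 3 ^ p1 = q 3 * b^-1 * q 3 ^+ 3.
  apply: (canLR (conjgKV _)).
  by rewrite !(conjMg, conjVg, conjXg) e1 e1b !expE !gnorm.
(* Here [b] is written as [q 3] times [p1 * q 3 * p1^-1]. *)
have bp1 : b ^ p1 = q 3 ^ p1 * q 3.
  apply: (canLR (conjgKV _)).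
  by rewrite conjMg conjgK e1 !gnorm.
split=> //; rewrite ?conjgVE ?unshift //.
- by rewrite q3p1 !(conjMg, conjVg, conjXg) -eb e0 !expE !gnorm.
- by rewrite conjMg bp1 q3p1 !(conjMg, conjVg, conjXg) -eb e0 !expE !gnorm.
- by rewrite -eb !gnorm.
- by rewrite conjMg -eb e0 !expE !gnorm.
- move=> j jn; apply: (mulIg (p0^-1 * p1)).
  by rewrite -mulgA (mulgA (q j)) -e1q // !gnorm e0q.
- by move=> j jn; rewrite e0q // !gnorm.
Qed.

(* Here t, p0 t and q_l t play the roles of a_1, a_2 and a_l; products are
   compared after moving every t to the right. *)
Section Shift.
Variables (t p0 p1 : H) (q a : nat -> H).
Hypotheses (n_ge4 : 4 <= n).
Hypotheses (t_p0 : t * p0 = p1 * t) (t_p1 : t * p1 = p0^-1 * p1 * t).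
Hypothesis t_q : forall l, 3 <= l <= n -> t * q l = q l * t.
Hypotheses (a1E : a 1%N = t) (a2E : a 2 = p0 * t).
Hypothesis aqE : forall l, 3 <= l <= n -> a l = q l * t.

Let t_qA x l : 3 <= l <= n -> x * t * q l = x * q l * t.
Proof. by move=> ln; rewrite -mulgA t_q // mulgA. Qed.
Let t_p0A x : x * t * p0 = x * p1 * t.
Proof. by rewrite -mulgA t_p0 mulgA. Qed.
Let t_p1A x : x * t * p1 = x * p0^-1 * p1 * t.
Proof. by rewrite -mulgA t_p1 !mulgA. Qed.

(** With every [t] on the right, the braid relation of a_1 and a_2 follows from [t_p0] and [t_p1]
    alone, commutation with a_1 is [t_q], and commutation of a_2 with a_l becomes
    [p0 * q l = q l * p1]. *)
Lemma artinE_relations_of_derivedE b :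
  derivedE_relations n p0 p1 b q -> artinE_relations n a.
Proof.
case=> eb _ e1 _ e0q _ br brl c cl.
(* This is the braid relation of a_2 and a_3 once the powers of [t] are cancelled. *)
have {}e1 : p0 * q 3 * p0^-1 * p1 = q 3 * p1 * q 3.
  by rewrite -eb; apply: (mulgI (q 3)^-1); rewrite mulgA -e1 !gnorm.
have a1l l : 3 <= l <= n -> a 1%N * a l = a l * a 1%N.
  by move=> ln; rewrite a1E aqE // mulgA t_q.
have a2l l : 4 <= l <= n -> a 2 * a l = a l * a 2.
  move=> ln; rewrite a2E aqE; last by lia.
  by rewrite !mulgA t_qA ?t_p0A ?e0q //; lia.
split=> [i j i1 ij jn ji|i iN i3|i iN|].
- have : i = 1%N \/ i = 2 \/ 3 <= i by lia.
  case=> [?|[?|?]]; try subst i.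
  + by apply: a1l; lia.
  + by apply: a2l; lia.
  by rewrite !aqE ?mulgA ?t_qA ?(c i j) //; lia.
- have : i = 1%N \/ i = 2 \/ 4 <= i by lia.
  case=> [?|[?|?]]; try subst i.
  + by apply: a1l; lia.
  + by apply: a2l; lia.
  by rewrite !aqE ?mulgA ?t_qA ?(cl i) //; lia.
- have : i = 1%N \/ i = 2 \/ 3 <= i by lia.
  case=> [?|[?|?]]; try subst i.
  + by rewrite a1E a2E !mulgA t_p0 !t_p0A t_p1A !gnorm.
  + rewrite a2E aqE; last by lia.
    by rewrite !mulgA !t_qA ?t_p0A ?t_p1A ?t_qA -?e1 //; lia.
  by rewrite !aqE ?mulgA ?t_qA ?(br i) //; lia.
- by rewrite !aqE ?mulgA ?t_qA ?brl //; lia.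
Qed.

(** The relations [e0q] and [e1] are read off from a_2 against a_j and a_3. Conjugating by [t]
    produces the rest of those involving [p0], [p1] or [b]: [e1] gives [e0], [e0] gives [e1b], and
    [e0q] gives [e1q]. *)
Lemma derivedE_relations_of_artinE b :
  b = p0 * q 3 * p0^-1 -> artinE_relations n a ->
  derivedE_relations n p0 p1 b q.
Proof.
move=> bE; case=> c cl br brl.
have p0t : p0 ^ t^-1 = p1 by rewrite -conjgVE t_p0 mulgK.
have p1t : p1 ^ t^-1 = p0^-1 * p1 by rewrite -conjgVE t_p1 mulgK.
have q3t : q 3 ^ t^-1 = q 3 by rewrite -conjgVE t_q ?mulgK //; lia.
have e0q j : 4 <= j <= n -> p0 * q j = q j * p1.
  move=> jn; have : a 2 * a j = a j * a 2.
    have : j = n \/ j <= n - 1 by lia.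
    by case=> [->|?]; [apply: cl|apply: c]; lia.
  rewrite a2E aqE; last by lia.
  rewrite !mulgA t_qA ?t_p0A; last by lia.
  by do 2 move/mulIg.
have eb : q 3 ^ p0^-1 = b by rewrite -conjgVE bE.
have e1 : q 3 ^ p1^-1 = (q 3)^-1 * b.
  have : a 2 * a 3 * a 2 = a 3 * a 2 * a 3 by apply: br; lia.
  rewrite a2E aqE; last by lia.
  rewrite !mulgA !(t_qA, t_p0A, t_p1A); try by lia.
  do 3 move/mulIg; move=> br3; rewrite -conjgVE.
  by apply: (mulgI (q 3)); apply: (mulIg p1); rewrite bE !gnorm -br3.
have bt : b ^ t^-1 = (q 3)^-1 * b.
  by rewrite -eb conjJg conjVg p0t q3t e1 eb.
(* Conjugation by [t] turns [p1] in [e1] into [p0^-1 * p1]; a further conjugation by [p0] isolates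
   the conjugate of [b]. *)
have e0 : b ^ p0^-1 = b ^+ 2 * (q 3)^-1 * b.
  have := congr1 (conjg^~ t^-1) e1.
  rewrite /= conjJg !conjVg p1t q3t conjMg conjVg q3t bt invgM invgK conjgM e1.
  move/(congr1 (conjg^~ p0^-1)); rewrite /= conjgK 2!conjMg !conjVg eb => e.
  by apply: (mulgI (b^-1 * b^-1)); rewrite -!mulgA -e !mulKg.
have e1b : b ^ p1^-1 = ((q 3)^-1 * b) ^+ 3 * (q 3) ^- 2 * b.
  have := congr1 (conjg^~ t^-1) e0.
  rewrite /= conjJg !conjVg p0t bt !conjMg !conjVg q3t bt e1.
  move/(congr1 ( *%g ((q 3)^-1 * b))); rewrite mulVKg => ->.
  by rewrite !expE !gnorm.
have e1q j : 4 <= j <= n -> p1 * q j = q j * p0^-1 * p1.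
  move=> jn; have := congr1 (conjg^~ t^-1) (e0q j jn).
  by rewrite /= !conjMg p0t p1t -!conjgVE t_q ?mulgK ?mulgA //; lia.
split; rewrite ?conjgVE //.
- move=> i i3; have := br i; rewrite !aqE; try by lia.
  rewrite !mulgA !t_qA; try by lia.
  by move=> /(_ ltac:(lia)); do 3 move/mulIg.
- move: brl; rewrite !aqE; try by lia.
  by rewrite !mulgA !t_qA; try lia; do 3 move/mulIg.
- move=> i j i3 ij jn ji; have := c i j; rewrite !aqE; try by lia.
  rewrite !mulgA !t_qA; try by lia.
  by move=> /(_ ltac:(lia) ij jn ji); do 2 move/mulIg.
- move=> i i4; have := cl i; rewrite !aqE; try by lia.
  rewrite !mulgA !t_qA; try by lia.
  by move=> /(_ ltac:(lia) ltac:(lia)); do 2 move/mulIg.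
Qed.
End Shift.
End Relations.

(** * The isomorphism onto the commutator subgroup *)

Lemma in_derivedJ (G : groupType) (x y : G) :
  in_derived x -> in_derived (y * x * y^-1).
Proof.
move=> dx; have -> : y * x * y^-1 = x * [~ x, y^-1].
  by rewrite /commg /conjg !gnorm.
by apply: in_derivedM => //; apply: in_derived_comm.
Qed.

(* x y x = y x y makes y the conjugate of x by x y. *)
Lemma in_derived_braid (G : groupType) (x y : G) :
  x * y * x = y * x * y -> in_derived (y * x^-1).
Proof.
move=> xy; have -> : y * x^-1 = [~ (x * y)^-1, x^-1].
  by rewrite /commg /conjg !gnorm xy !gnorm.
exact: in_derived_comm.
Qed.

Section DerivedArtin.
Variable n : nat.
Hypothesis n_ge4 : 4 <= n.

Local Notation P := (presented (@derivedE_rel n)).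
Local Notation gen := (pres_gen (@derivedE_rel n)).
Local Notation a := (@artinE_gen n).

Let p0 : P := gen (Ip0 n).
Let p1 : P := gen (Ip1 n).
Let b : P := gen (Ib n).
Let q : nat -> P := at_index (fun l : interval 3 n => gen (Iq l)).

Lemma presented_derivedE : derivedE_relations n p0 p1 b q.
Proof. exact/respects_derivedE/respects_pres_gen. Qed.

Lemma presented_artinE : artinE_relations n a.
Proof. exact/respects_artinE/respects_pres_gen. Qed.

Lemma qE (l : interval 3 n) : q (val l) = gen (Iq l).
Proof. by rewrite /q /at_index valK. Qed.

(** * The automorphism phi of P *)

Definition shift_gen (x : derivedE_index n) : P :=
  match x with
  | Ip0 => p1
  | Ip1 => p0^-1 * p1
  | Ib => (q 3)^-1 * b
  | Iq l => gen (Iq l)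
  end.

(** Obtained by solving phi for the generators: [p1] is the image of [p0], hence [p0] that of
    [p0 * p1^-1], and [b] that of [q 3 * b]. *)
Definition unshift_gen (x : derivedE_index n) : P :=
  match x with
  | Ip0 => p0 * p1^-1
  | Ip1 => p0
  | Ib => q 3 * b
  | Iq l => gen (Iq l)
  end.

Lemma respects_shift_gen : respects (@derivedE_rel n) shift_gen.
Proof.
exact/respects_derivedE/(derivedE_relations_shift presented_derivedE).
Qed.

Lemma respects_unshift_gen : respects (@derivedE_rel n) unshift_gen.
Proof.
exact/respects_derivedE/(derivedE_relations_unshift presented_derivedE).
Qed.

Definition shift := pres_lift respects_shift_gen.
Definition unshift := pres_lift respects_unshift_gen.
HB.instance Definition _ := UMagmaMorphism.on shift.
HB.instance Definition _ := UMagmaMorphism.on unshift.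

Lemma shiftE x : shift (gen x) = shift_gen x.
Proof. exact: pres_lift_gen. Qed.

Lemma unshiftE x : unshift (gen x) = unshift_gen x.
Proof. exact: pres_lift_gen. Qed.

Lemma shift_q l : shift (q l) = q l.
Proof.
rewrite /q /at_index; case: insub => [k|] /=; last exact: gmulf1.
exact: shiftE.
Qed.

Lemma unshift_q l : unshift (q l) = q l.
Proof.
rewrite /q /at_index; case: insub => [k|] /=; last exact: gmulf1.
exact: unshiftE.
Qed.

Lemma shiftK : cancel shift unshift.
Proof.
move=> x; rewrite -[LHS]/((unshift \o shift) x) -[RHS]/(idfun x).
apply: pres_hom_ext => -[|||l] /=; rewrite shiftE /= ?(gmulfM, gmulfV) /=;
  by rewrite ?unshift_q !unshiftE /= ?gnorm.
Qed.

Lemma unshiftK : cancel unshift shift.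
Proof.
move=> x; rewrite -[LHS]/((shift \o unshift) x) -[RHS]/(idfun x).
apply: pres_hom_ext => -[|||l] /=; rewrite unshiftE /= ?(gmulfM, gmulfV) /=;
  by rewrite ?shift_q !shiftE /= ?gnorm.
Qed.

(** * The action of the Artin group on P *)

Definition shift_bij : bijection P := Bijection shiftK unshiftK.

(** This is multiplicativity of phi, and it gives [shift_bij] the commutation rules required of
    [t]. *)
Lemma shift_bij_lmul x : shift_bij * lmul x = lmul (shift x) * shift_bij.
Proof. by apply: bijection_ext => y /=; rewrite gmulfM. Qed.

(** The last branch is meant for indices from 3 to [n]; at 0 and above [n], [q i] is 1. *)
Definition artinE_action (i : nat) : bijection P :=
  match i with
  | 1 => shift_bij
  | 2 => lmul p0 * shift_bij
  | _ => lmul (q i) * shift_bij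
  end.

Lemma artinE_action_relations :
  artinE_relations n
    (at_index (fun l : interval 1 n => artinE_action (val l))).
Proof.
apply: (@artinE_relations_of_derivedE n (bijection P) shift_bij (lmul p0)
  (lmul p1) (lmul \o q) _ n_ge4 _ _ _ _ _ _ (lmul b)) => //.
- by rewrite shift_bij_lmul shiftE.
- by rewrite shift_bij_lmul shiftE /= gmulfM gmulfV.
- by move=> l _; rewrite /= shift_bij_lmul shift_q.
- by rewrite at_indexE //; lia.
- by rewrite at_indexE //; lia.
- by move=> [|[|[|l]]] //= ln; rewrite at_indexE //; lia.
(* The relations of P pass to bijections along the homomorphism [lmul]. *)
exact: derivedE_relations_hom presented_derivedE.
Qed.

Definition artinE_act : artinE n -> bijection P :=
  pres_lift ((respects_artinE _).2 artinE_action_relations).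
HB.instance Definition _ := UMagmaMorphism.on artinE_act.

Lemma artinE_act_gen i : 1 <= i <= n -> artinE_act (a i) = artinE_action i.
Proof.
move=> ihi; rewrite /artinE_gen /at_index (insubT (fun k => 1 <= k <= n)) /=.
exact: pres_lift_gen.
Qed.

(** * The homomorphism from P to the Artin group and its injectivity *)

Lemma gen_a (l : interval 1 n) : a (val l) = pres_gen (@artinE_rel n) l.
Proof. by rewrite /artinE_gen /at_index valK. Qed.

Lemma elt_q i : 3 <= i <= n ->
  at_index (fun l : interval 3 n => derivedE_elt (Iq l)) i = a i * (a 1%N)^-1.
Proof. exact: (at_indexE (fun i => a i * (a 1%N)^-1)). Qed.

(** Conjugation by a_1 follows the formulas of phi: the first identity holds in any group, the
    second is the braid relation of a_1 and a_2, the third is commutation of a_1 with a_l. *)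
Lemma artinE_shift :
  [/\ a 1%N * derivedE_elt (Ip0 n) = derivedE_elt (Ip1 n) * a 1%N,
   a 1%N * derivedE_elt (Ip1 n) =
     (derivedE_elt (Ip0 n))^-1 * derivedE_elt (Ip1 n) * a 1%N
  & forall l, 3 <= l <= n ->
     a 1%N * (a l * (a 1%N)^-1) = a l * (a 1%N)^-1 * a 1%N].
Proof.
case: presented_artinE => c cl br _; split=> /=.
- by rewrite expgS expg1 !gnorm.
- have br1 : a 1%N * a 2 * a 1%N = a 2 * a 1%N * a 2 by apply: br; lia.
  apply: (mulgI (a 2 * (a 1%N)^-1)); apply: (mulIg (a 1%N)).
  by rewrite expgS expg1 !gnorm -br1 mulgK.
- move=> l ln; rewrite mulgVK mulgA.
  suff -> : a 1%N * a l = a l * a 1%N by rewrite mulgK.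
  have : l = n \/ l <= n - 1 by lia.
  by case=> [->|?]; [apply: cl|apply: c]; lia.
Qed.

Lemma derivedE_elt_relations :
  derivedE_relations n (derivedE_elt (Ip0 n)) (derivedE_elt (Ip1 n))
    (derivedE_elt (Ib n)) (at_index (fun l => derivedE_elt (@Iq n l))).
Proof.
have [s0 s1 sq] := artinE_shift.
apply: (@derivedE_relations_of_artinE _ _ (a 1%N) _ _ _ a) => //.
- by move=> l ln; rewrite elt_q // sq.
- by rewrite /= mulgVK.
- by move=> l ln; rewrite elt_q // mulgVK.
- by rewrite elt_q /= ?gnorm //; lia.
- exact: presented_artinE.
Qed.

Definition derivedE_map : P -> artinE n :=
  pres_lift ((respects_derivedE _).2 derivedE_elt_relations).
HB.instance Definition _ := UMagmaMorphism.on derivedE_map.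

Lemma derivedE_map_gen x : derivedE_map (gen x) = derivedE_elt x.
Proof. exact: pres_lift_gen. Qed.

Lemma derivedE_map_q i : 3 <= i <= n -> derivedE_map (q i) = a i * (a 1%N)^-1.
Proof.
move=> ihi; rewrite /q /at_index (insubT (fun k => 3 <= k <= n)) /=.
exact: pres_lift_gen.
Qed.

(** Both sides are homomorphisms in [x], so generators suffice. In a_i a_1^-1 the two copies of phi
    cancel; [p1] needs [shift_bij_lmul], and [b] needs the relation [b = p0 * q 3 * p0^-1]. *)
Lemma act_derivedE_map x : artinE_act (derivedE_map x) = lmul x.
Proof.
have act1 : artinE_act (a 1%N) = shift_bij by rewrite artinE_act_gen //; lia.
have act2 : artinE_act (a 2) = lmul p0 * shift_bij.
  by rewrite artinE_act_gen //; lia.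
have actq l : 3 <= l <= n -> artinE_act (a l) = lmul (q l) * shift_bij.
  by move=> ln; rewrite artinE_act_gen; [case: l ln => [|[|[]]]|lia].
rewrite -[LHS]/((artinE_act \o derivedE_map) x).
apply: pres_hom_ext => {x} -[|||l] /=; rewrite derivedE_map_gen /=.
- by rewrite gmulfM gmulfV /= act1 act2 mulgK.
- rewrite !gmulfM gmulfV gmulfXn /= act1 act2 mulgA shift_bij_lmul.
  by rewrite shiftE expgS expg1 !gnorm.
- rewrite !gmulfM !gmulfV /= act1 act2 actq; last by lia.
  by rewrite !gnorm -gmulfV -!gmulfM -(rE_b presented_derivedE).
- by rewrite gmulfM gmulfV /= act1 (actq _ (valP l)) mulgK -qE.
Qed.

Lemma derivedE_map_inj : injective derivedE_map.
Proof.
by move=> x y /(congr1 artinE_act); rewrite !act_derivedE_map => /lmul_inj.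
Qed.

(** * Normality of the image and comparison with the commutator subgroup *)

Lemma derivedE_map_shift x :
  derivedE_map (shift x) = a 1%N * derivedE_map x * (a 1%N)^-1.
Proof.
have [s0 s1 sq] := artinE_shift.
elim/presented_ind: x => [|x|x y IHx IHy|x IHx].
- by rewrite !gmulf1 mulg1 mulgV.
- rewrite shiftE; case: x => [|||[l ln]].
  + by rewrite !derivedE_map_gen s0 mulgK.
  + by rewrite gmulfM gmulfV /= !derivedE_map_gen s1 mulgK.
  (* Conjugation by a_1 takes [p0] to [p1] and fixes [q 3], so it takes b = p0 q3 p0^-1 to p1 q3
     p1^-1 = q3^-1 b. *)
  + have e1 := rE_p1q3 derivedE_elt_relations.
    have eb := rE_b derivedE_elt_relations.
    rewrite elt_q in e1 eb; last by lia.
    rewrite gmulfM gmulfV /= derivedE_map_q ?derivedE_map_gen -?e1; last by lia.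
    have p0t : derivedE_elt (Ip0 n) ^ (a 1%N)^-1 = derivedE_elt (Ip1 n).
      by rewrite -conjgVE s0 mulgK.
    have q3t : (a 3 * (a 1%N)^-1) ^ (a 1%N)^-1 = a 3 * (a 1%N)^-1.
      by rewrite -conjgVE sq ?mulgK //; lia.
    by rewrite eb !conjgVE conjJg conjVg p0t q3t.
  + by rewrite !derivedE_map_gen [derivedE_elt _]/= sq // mulgK.
- by rewrite !gmulfM /= IHx IHy !gnorm.
- by rewrite !gmulfV /= IHx !gnorm.
Qed.

Lemma a_div_a1 i : 1 <= i <= n -> exists x, derivedE_map x = a i * (a 1%N)^-1.
Proof.
move=> ihi; have : i = 1%N \/ i = 2 \/ 3 <= i by lia.
case=> [?|[?|?]]; try subst i.
- by exists 1; rewrite gmulf1 mulgV.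
- by exists p0; rewrite derivedE_map_gen.
- by exists (q i); rewrite derivedE_map_q //; lia.
Qed.

Lemma derivedE_map_conj x y :
  exists z, derivedE_map z = y * derivedE_map x * y^-1.
Proof.
(* Conjugation by [y^-1] is included because the induction on [y] passes through inverses, which
   exchange the two claims. *)
suff [//] : (exists z, derivedE_map z = y * derivedE_map x * y^-1) /\
  exists z, derivedE_map z = y^-1 * derivedE_map x * y.
elim/presented_ind: y x => [|i|y y' IHy IHy'|y IHy] x.
- by split; exists x; rewrite !gnorm.
- have [w wE] := a_div_a1 (valP i); rewrite /= gen_a in wE *.
  (* Conjugation by a generator is thus phi followed by an inner automorphism of the image. *)
  have -> : pres_gen (@artinE_rel n) i = derivedE_map w * a 1%N.
    by rewrite wE mulgVK.
  split.
    exists (w * shift x * w^-1).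
    by rewrite !gmulfM gmulfV /= derivedE_map_shift !gnorm.
  exists (unshift (w^-1 * x * w)).
  apply: (mulgI (a 1%N)); apply: (mulIg (a 1%N)^-1).
  rewrite -derivedE_map_shift unshiftK !gmulfM gmulfV /=.
  by rewrite !gnorm.
- split.
    have [[z zE] _] := IHy' x; have [[z' z'E] _] := IHy z.
    by exists z'; rewrite z'E zE !gnorm.
  have [_ [z zE]] := IHy x; have [_ [z' z'E]] := IHy' z.
  by exists z'; rewrite z'E zE !gnorm.
- by rewrite invgK; have [? ?] := IHy x; split.
Qed.

(** Each a_i a_1^-1 telescopes along the diagram into quotients of adjacent generators, which are
    commutators by the braid relations. The image of [p1] is conjugate to that of [p0], and the
    image of [b] is a_2 a_1^-1 times a_3 a_2^-1. *)
Lemma derivedE_map_derived x : in_derived (derivedE_map x).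
Proof.
case: presented_artinE => c cl br brl.
have d1 i : 1 <= i <= n -> in_derived (a i * (a 1%N)^-1).
  have step k : 1 <= k <= n - 1 -> in_derived (a k * (a 1%N)^-1).
    elim: k => [//|[|k] IHk] kn; first by rewrite mulgV; apply: in_derived1.
    rewrite -(mulgVK (a k.+1) (a k.+2)) -mulgA; apply: in_derivedM.
      by apply: in_derived_braid; apply: br; lia.
    by apply: IHk; lia.
  move=> ihi; have : i = n \/ i <= n - 1 by lia.
  case=> [->|?]; last by apply: step; lia.
  rewrite -(mulgVK (a 3) (a n)) -mulgA; apply: in_derivedM.
    exact: in_derived_braid.
  by apply: step; lia.
elim/presented_ind: x => [|x|x y dx dy|x dx].
- by rewrite gmulf1; apply: in_derived1.
- rewrite derivedE_map_gen; case: x => [|||[l ln]] /=; last by apply: d1; lia.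
  + by apply: d1; lia.
  + have -> : a 1%N * a 2 * a 1%N ^- 2 =
        a 1%N * (a 2 * (a 1%N)^-1) * (a 1%N)^-1.
      by rewrite expgS expg1 !gnorm.
    by apply: in_derivedJ; apply: d1; lia.
  + rewrite -mulgA; apply: in_derivedM; first by apply: d1; lia.
    by apply: in_derived_braid; apply: br; lia.
- by rewrite gmulfM; apply: in_derivedM.
- by rewrite gmulfV; apply: in_derivedV.
Qed.

Lemma derivedE_map_surj x : in_derived x -> exists y, derivedE_map y = x.
Proof.
have n1 : 1 <= 1 <= n by lia.
(* The reference generator is a_1 and the normal subgroup is the image of P. *)
apply: (@in_derived_modulo _ _ (fun z => exists y, derivedE_map y = z)
  (exist _ 1%N n1)).
- by exists 1; rewrite gmulf1.
- by move=> _ _ [y <-] [z <-]; exists (y * z); rewrite gmulfM.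
- by move=> _ [y <-]; exists y^-1; rewrite gmulfV.
- by move=> _ y [z <-]; apply: derivedE_map_conj.
- move=> [i ihi]; have [y yE] := a_div_a1 ihi; exists y; rewrite yE.
  by rewrite -!gen_a.
Qed.

Lemma derivedE_elt_derived (x : derivedE_index n) :
  derived_pred (derivedE_elt x).
Proof.
by apply/asboolP; rewrite -derivedE_map_gen; apply: derivedE_map_derived.
Qed.

Definition derivedE_gen (x : derivedE_index n) : derived (artinE n) :=
  exist _ (derivedE_elt x) (derivedE_elt_derived x).

Definition derivedE_iso (x : P) : derived (artinE n) :=
  exist _ (derivedE_map x) (introT (asboolP _) (derivedE_map_derived x)).

Lemma derivedE_iso_morphism : monoid_morphism derivedE_iso.
Proof.
by split=> [|x y]; apply: val_inj; rewrite /= ?gmulf1 ?gmulfM.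
Qed.

HB.instance Definition _ :=
  isUMagmaMorphism.Build P (derived (artinE n)) derivedE_iso
    derivedE_iso_morphism.

Lemma derivedE_iso_bij : bijective derivedE_iso.
Proof.
have iso_surj y : exists x, derivedE_iso x = y.
  have [x xE] := derivedE_map_surj (elimT (asboolP _) (valP y)).
  by exists x; apply: val_inj.
(* Choice turns surjectivity into a right inverse, which injectivity makes two-sided. *)
have [f fK] := choice iso_surj.
exists f => // x; apply: derivedE_map_inj.
by rewrite -[LHS]/(val (derivedE_iso _)) fK.
Qed.

Lemma derivedE_presentation : has_presentation derivedE_gen (@derivedE_rel n).
Proof.
exists derivedE_iso; split; first exact: derivedE_iso_bij.
by move=> x; apply: val_inj; apply: derivedE_map_gen.
Qed.
End DerivedArtin.

(** * Finiteness of the presentation *)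

Section DerivedIndex.
Variable n : nat.
Hypothesis n_ge2 : 2 <= n.

(** As the q_l start at 3, the values 0, 1, 2 are free for the other generators, and the numbering
    fills 0 to [n] without gaps. *)
Definition derivedE_index_nat (x : derivedE_index n) : nat :=
  match x with Ip0 => 0 | Ip1 => 1 | Ib => 2 | Iq l => val l end.

(** The default [Ib n] in the last branch is reached only for [i] above [n]. *)
Definition derivedE_index_of_nat (i : nat) : derivedE_index n :=
  match i with
  | 0 => Ip0 n
  | 1 => Ip1 n
  | 2 => Ib n
  | i => oapp (@Iq n) (Ib n) (insub i)
  end.

Lemma derivedE_index_natK : cancel derivedE_index_nat derivedE_index_of_nat.
Proof.
case=> [|||[[|[|[|l]]] ln]] //=.
by rewrite insubT /=; congr (Iq _); apply: val_inj.
Qed.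

Lemma derivedE_index_of_natK i :
  i <= n -> derivedE_index_nat (derivedE_index_of_nat i) = i.
Proof.
move: i => [|[|[|i]]] // ilt; rewrite /derivedE_index_of_nat.
by rewrite (insubT (fun k => 3 <= k <= n)).
Qed.

Lemma derivedE_index_nat_lt x : derivedE_index_nat x < n.+1.
Proof. by case: x => [|||[l /= /andP[]]] //=; lia. Qed.

Lemma derivedE_index_ord_bij :
  bijective (fun x => Ordinal (derivedE_index_nat_lt x)).
Proof.
exists (fun i : 'I_n.+1 => derivedE_index_of_nat i) => [x|i] /=.
  exact: derivedE_index_natK.
by apply: val_inj => /=; rewrite derivedE_index_of_natK // -ltnS.
Qed.

End DerivedIndex.

(** A finite list containing all relations is enough: every shape is listed for all indices up to
    [n], and [has_presentation_finite] discards the entries that are not relations. *)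
Lemma derivedE_rel_finite n :
  exists L : seq (free_group (derivedE_index n) * free_group (derivedE_index n)),
  forall u v, @derivedE_rel n u v -> (u, v) \in L.
Proof.
pose p0 := free_gen (Ip0 n); pose p1 := free_gen (Ip1 n).
pose b := free_gen (Ib n).
pose q := at_index (fun l : interval 3 n => free_gen (Iq l)).
pose shapes i j := [:: (b, p0 * q 3 * p0^-1);
  (p0 * b * p0^-1, b ^+ 2 * (q 3)^-1 * b);
  (p1 * q 3 * p1^-1, (q 3)^-1 * b);
  (p1 * b * p1^-1, ((q 3)^-1 * b) ^+ 3 * (q 3) ^- 2 * b);
  (p0 * q j, q j * p1);
  (p1 * q j, q j * p0^-1 * p1);
  (q i * q i.+1 * q i, q i.+1 * q i * q i.+1);
  (q n * q 3 * q n, q 3 * q n * q 3);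
  (q i * q j, q j * q i)].
exists (flatten [seq shapes i j | i <- iota 0 n.+1, j <- iota 0 n.+1]).
move=> u v Ruv.
suff [i [j [ilt jlt uv]]] :
    exists i j, [/\ i <= n, j <= n & (u, v) \in shapes i j].
  apply/flattenP; exists (shapes i j) => //.
  by apply/allpairsP; exists (i, j); rewrite !mem_iota.
case: Ruv => [||||j jn|j jn|i iN||i j i3 ij jn ji|i iN].
1-4: by exists 0%N, 0%N; split=> //; rewrite !inE eqxx ?orbT.
- by exists 0%N, j; split; [|lia|rewrite !inE eqxx ?orbT].
- by exists 0%N, j; split; [|lia|rewrite !inE eqxx ?orbT].
- by exists i, 0%N; split; [lia| |rewrite !inE eqxx ?orbT].
- by exists 0%N, 0%N; split=> //; rewrite !inE eqxx ?orbT.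
- by exists i, j; split; [lia|lia|rewrite !inE eqxx ?orbT].
(* Commutation with q_n is the last shape taken at [j = n]. *)
- by exists i, n; split; [lia| |rewrite !inE eqxx ?orbT].
Qed.

Theorem theorem3p13 (n : nat) (hn : n = 6 \/ n = 7 \/ n = 8) :
  finitely_presented (derived (artinE n)) /\
  exists g : derivedE_index n -> derived (artinE n),
    (forall x : derivedE_index n, val (g x) = derivedE_elt x) /\
    has_presentation g (@derivedE_rel n).
Proof.
have n_ge4 : 4 <= n by lia.
have n_ge2 : 2 <= n by lia.
have pres := derivedE_presentation n_ge4; split; last first.
  by exists (derivedE_gen n_ge4).
have [L RL] := derivedE_rel_finite n.
exact: has_presentation_finite (derivedE_index_ord_bij n_ge2) RL pres.
Qed.
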